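(* There exists an absolute constant $c>0$ for which the following holds. Let $\mathcal F\subset L_2(\mu)$ be a class that is star-shaped around one of its points (i.e., for some $f_0\in\mathcal F$ and every $f\in\mathcal F$, the segment $[f_0,f]$ is contained in $\mathcal F$), let $X\sim\mu$, let $W$ be a centered gaussian random variable with variance $\sigma^2>0$ that is independent of $X$, and let $\mathcal Y=\{Y^f=f(X)+W:\ f\in\mathcal F\}$. If a learning procedure $\tilde f_N$ performs with accuracy $\varepsilon_N>0$ and confidence parameter $0<\delta_N<1/4$ for every target $Y^f\in\mathcal Y$, then $$\varepsilon_N\ \ge\ \min\Big\{c\,\sigma^2\,\frac{\log(1/\delta_N)}{N},\ \frac14\,\mathrm{diam}^2(\mathcal F,L_2(\mu))\Big\}.$$
   Context: $\mu$ is a probability measure on a space $\Omega$. A learning procedure is a map $\tilde f_N$ from $(\Omega\times\mathbb R)^N$ into $\mathcal F$. For a target $Y$, the risk is $R(f)=\mathbb E(f(X)-Y)^2$, and $R(\tilde f_N)=\mathbb E\big((\tilde f_N(X)-Y)^2\mid \mathcal D\big)$, where $\mathcal D=(X_i,Y_i)_{i=1}^N$ are $N$ i.i.d. copies of $(X,Y)$ to which $\tilde f_N$ is applied and $(X,Y)$ is independent of $\mathcal D$. The procedure performs with accuracy $\varepsilon_N$ and confidence parameter $\delta_N$ for every target in $\mathcal Y$ if for every $Y\in\mathcal Y$, $R(\tilde f_N)\le\inf_{f\in\mathcal F}R(f)+\varepsilon_N$ with probability at least $1-\delta_N$ (with respect to the law of the sample). For $Y=Y^f$ with $f\in\mathcal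 F$ this says that $\|\tilde f_N-f\|_{L_2(\mu)}^2\le\varepsilon_N$ with probability at least $1-\delta_N$. $\mathrm{diam}(\mathcal F,L_2(\mu))=\sup_{f,h\in\mathcal F}\|f-h\|_{L_2(\mu)}$. *)

(* Defs.v *)
From HB Require Import structures.
From mathcomp Require Export all_boot all_order all_algebra.
From mathcomp Require Export all_classical all_reals all_analysis.
Export Order.TTheory GRing.Theory Num.Theory.
Export numFieldNormedType.Exports.

Set Implicit Arguments.
Unset Strict Implicit.
Unset Printing Implicit Defensive.

Local Open Scope classical_set_scope.
Local Open Scope ring_scope.

Section power_probability.
Context d (T : measurableType d) (R : realType).

Definition cons_pair n (x : T * n.-tuple T) : n.+1.-tuple T :=
  [the n.+1.-tuple T of x.1 :: x.2].

Lemma measurable_cons_pair n : measurable_fun [set: T * n.-tuple T] (@cons_pair n).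
Proof. exact: measurable_cons measurable_fst measurable_snd. Qed.

HB.instance Definition _ n :=
  isMeasurableFun.Build _ _ _ _ (@cons_pair n) (@measurable_cons_pair n).

(* The n-fold product of P, i.e. the law of n i.i.d. draws from P, on the
   product sigma-algebra of n.-tuple T. *)
Fixpoint power_prob (P : probability T R) n : probability (n.-tuple T) R :=
  match n with
  | 0 => \d_([tuple] : 0.-tuple T)
  | m.+1 => distribution (P \x power_prob P m)%E (@cons_pair m)
  end.

Lemma power_prob_box (P : probability T R) n (A : 'I_n -> set T) :
  (forall i, measurable (A i)) ->
  power_prob P n [set s | forall i, A i (tnth s i)] =
  (\prod_(i < n) P (A i))%E.
Proof.
elim: n A => [|n IHn] A mA /=.
  rewrite big_ord0 diracE mem_set//= => i; by case: i.
rewrite big_ord_recl /distribution /pushforward.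
rewrite (_ : _ @^-1` _ = A ord0 `*`
    [set s : n.-tuple T | forall i, A (lift ord0 i) (tnth s i)]); last first.
  apply/seteqP; split => [[x s] /= h|[x s] /= [h0 hS] i].
    split; first by have := h ord0; rewrite /cons_pair /= tnth0.
    by move=> i; have := h (lift ord0 i); rewrite /cons_pair /= tnthS.
  by case: (unliftP ord0 i) => [j|] ->; rewrite /cons_pair /= ?tnthS ?tnth0.
rewrite product_measure1E//; last first.
  rewrite (_ : [set _ | _] =
      \bigcap_(i in [set: 'I_n]) ((fun s => tnth s i) @^-1` A (lift ord0 i))).
    apply: fin_bigcap_measurable => [|i _]; first exact: finite_finset.
    by rewrite -[X in measurable X]setTI; exact: measurable_tnth.
  by apply/seteqP; split => [s /= h i _|s /= h i]; exact: h.
by congr (_ * _)%E; apply: (IHn (fun i => A (lift ord0 i))) => i; exact: mA.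
Qed.

End power_probability.

Section learning.
Context (R : realType) d (Omega : measurableType d) d' (T : measurableType d')
  (P : probability T R).

Definition rv_pair (X : {RV P >-> Omega}) (Y : {RV P >-> R}) (t : T) :
  Omega * R := (X t, Y t).

Lemma measurable_rv_pair (X : {RV P >-> Omega}) (Y : {RV P >-> R}) :
  measurable_fun [set: T] (rv_pair X Y).
Proof. by apply: measurable_fun_pair; exact: measurable_funPT. Qed.

HB.instance Definition _ (X : {RV P >-> Omega}) (Y : {RV P >-> R}) :=
  isMeasurableFun.Build _ _ _ _ (rv_pair X Y) (measurable_rv_pair X Y).

Definition sample_law (X : {RV P >-> Omega}) (Y : {RV P >-> R}) (N : nat) :
    probability (N.-tuple (Omega * R)%type) R :=
  power_prob (distribution P (rv_pair X Y)) N.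

Definition independent_rv (X : {RV P >-> Omega}) (W : {RV P >-> R}) : Prop :=
  forall A B, measurable A -> measurable B ->
    P ((X @^-1` A) `&` (W @^-1` B)) = (P (X @^-1` A) * P (W @^-1` B))%E.

Definition risk (X : {RV P >-> Omega}) (Y : {RV P >-> R}) (f : Omega -> R) :
    \bar R := 'E_P[(fun t => (f (X t) - Y t) ^+ 2)%R]%E.

(* Since (X, Y) is independent of the sample s, the conditional risk of the
   procedure given s is the risk of the fixed function fN s.  No measurability
   is imposed on fN, so an event has probability at least 1 - delta when it
   contains a measurable set of probability at least 1 - delta; for measurable
   events this is the usual meaning. *)
Definition performs (F : set (Omega -> R)) (X : {RV P >-> Omega})
    (calY : set {RV P >-> R}) (N : nat)
    (fN : N.-tuple (Omega * R)%type -> Omega -> R) (eps delta : R) : Prop :=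
  forall Y, calY Y ->
    exists A : set (N.-tuple (Omega * R)%type),
      [/\ measurable A,
          A `<=` [set s | (risk X Y (fN s) <=
                           ereal_inf [set risk X Y f | f in F] + eps%:E)%E] &
          ((1 - delta)%:E <= sample_law X Y N A)%E].

Definition targets (F : set (Omega -> R)) (X : {RV P >-> Omega})
    (W : {RV P >-> R}) : set {RV P >-> R} :=
  [set Y : {RV P >-> R} | exists2 f, F f & forall t, Y t = f (X t) + W t].

End learning.

Definition star_shaped (R : realType) (U : Type) (F : set (U -> R)) : Prop :=
  exists2 f0, F f0 & forall f t, F f -> 0 <= t <= 1 ->
    F (fun x => (1 - t) * f0 x + t * f x).

Definition L2_diam d (Omega : measurableType d) (R : realType)
    (mu : probability Omega R) (F : set (Omega -> R)) : \bar R :=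
  ereal_sup [set 'N[mu]_2[EFin \o (f \- h)%R]%E | f in F & h in F].

(* Main.v *)
(* Star-shapedness provides [u] and [v] in [F] whose squared distance [D] lies
   in (4 eps, 5 eps].  The balls of squared radius eps around [u] and [v] are
   then disjoint, so the procedure would distinguish the N-fold laws of
   [(X, u X + W)] and [(X, v X + W)] with both errors at most delta.  The
   squared Hellinger affinity of two laws that can be so distinguished is at
   most 4 delta (1 - delta) <= delta^(1/6).  For these laws it is at least
   exp (- N D / (4 sigma^2)): it is exp (- (a - b)^2 / (4 sigma^2)) for gaussians
   centered at [a] and [b], Jensen's inequality integrates this over [X], and
   it is multiplicative in products.  Hence
   eps >= D / 5 >= (2/15) sigma^2 log (1 / delta) / N. *)
Require Import Defs.
From mathcomp Require Import measurable_realfun.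
From mathcomp Require Import ring lra.

Set Implicit Arguments.
Unset Strict Implicit.
Unset Printing Implicit Defensive.

Local Open Scope classical_set_scope.
Local Open Scope ring_scope.

(** * Cauchy-Schwarz and Jensen in a single inequality for integrals *)

Section overlap_core.
Context (R : realType).

(** With [C] the square root, AM-GM gives [f / a + g / b >= 2 * C * expR ((I - w) / 2)], and the
    tangent of the exponential at [w = I] bounds this below by [C * (2 + I - w)]. The result is
    affine in [w], hence ready to be integrated. *)
Lemma tangent_amgm (a b k I w f g : R) : 0 < a -> 0 < b -> 0 < k ->
  0 <= f -> 0 <= g -> k * expR (- w) <= f * g ->
  Num.sqrt (k * expR (- I) / (a * b)) * (2 + I) <=
  f / a + g / b + Num.sqrt (k * expR (- I) / (a * b)) * w.
Proof.
move=> a0 b0 k0 f0 g0 kfg.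
set C := Num.sqrt _.
have C0 : 0 <= C by exact: sqrtr_ge0.
have CE : C ^+ 2 = k * expR (- I) / (a * b).
  by rewrite sqr_sqrtr// divr_ge0 ?mulr_ge0 ?expR_ge0// ltW.
set p := f / a; set q := g / b.
have p0 : 0 <= p by rewrite divr_ge0// ltW.
have q0 : 0 <= q by rewrite divr_ge0// ltW.
set e := expR ((I - w) / 2).
have e1 : 1 + (I - w) / 2 <= e by exact: expR_ge1Dx.
have e0 : 0 < e by exact: expR_gt0.
have eE : e ^+ 2 = expR (I - w).
  by rewrite expr2 -expRD; congr expR; lra.
have pq : (C * e) ^+ 2 <= p * q.
  have -> : (C * e) ^+ 2 = k * expR (- w) / (a * b).
    have -> : expR (- w) = expR (- I) * expR (I - w).
      by rewrite -expRD addKr.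
    by rewrite exprMn CE eE mulrA mulrAC.
  by rewrite /p /q mulf_div ler_pM2r ?invr_gt0 ?mulr_gt0.
have : 2 * (C * e) <= p + q.
  have Ce0 : 0 <= C * e by rewrite mulr_ge0// ltW.
  have Ce2 : 0 <= 2 * (C * e) by exact: mulr_ge0.
  rewrite -(ler_pXn2r (n := 2))// ?nnegrE//; last exact: addr_ge0.
  have := sqr_ge0 (p - q); nra.
have := ler_wpM2l C0 e1; lra.
Qed.

Context d (T : measurableType d).

Lemma integral_gt0 (P : probability T R) (F : T -> \bar R) :
  measurable_fun [set: T] F -> (forall x, (0 < F x)%E) -> (0 < \int[P]_x F x)%E.
Proof.
move=> mF F0; rewrite lt0e integral_ge0 ?andbT; last by move=> x _; exact/ltW.
apply/eqP => intF0.
have [+ _] := ae_eq_integral_abs P measurableT mF.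
under eq_integral do rewrite gee0_abs ?ltW//.
move=> /(_ intF0)[N [mN PN0 /= sN]].
suff NT : N = [set: T].
  by have := @probability_setT _ _ _ P; rewrite -NT PN0 => /esym/eqP;
    rewrite eqe oner_eq0.
apply/seteqP; split => // x _; apply: sN => /= /(_ I) Fx0.
by have := F0 x; rewrite Fx0 ltxx.
Qed.

(** Let [a] and [b] be the integrals of [F] and [G]. Integrating [tangent_amgm] gives
    [C * (2 + I) <= 1 + 1 + C * I], so [C <= 1], which is the claim. It serves twice: with constant
    [w] for two gaussians, and with varying [w] to integrate over [mu]. *)
Lemma overlap_core (P : probability T R) (w : T -> R) (I k : R)
    (F G : T -> \bar R) :
  measurable_fun [set: T] w -> (forall x, 0 <= w x) ->
  (\int[P]_x (w x)%:E = I%:E)%E ->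
  measurable_fun [set: T] F -> measurable_fun [set: T] G ->
  (forall x, (0 <= F x)%E) -> (forall x, (0 <= G x)%E) -> 0 < k ->
  (forall x, ((k * expR (- w x))%:E <= F x * G x)%E) ->
  ((k * expR (- I))%:E <= \int[P]_x F x * \int[P]_x G x)%E.
Proof.
move=> mw w0 intw mF mG F0 G0 k0 kFG.
have FG0 x : (0 < F x * G x)%E.
  by apply: lt_le_trans (kFG x); rewrite lte_fin mulr_gt0// expR_gt0.
have Fp x : (0 < F x)%E.
  by rewrite lt0e F0 andbT; apply/eqP => Fx0; have := FG0 x; rewrite Fx0 mul0e ltxx.
have Gp x : (0 < G x)%E.
  by rewrite lt0e G0 andbT; apply/eqP => Gx0; have := FG0 x; rewrite Gx0 mule0 ltxx.
have := integral_gt0 P mF Fp; have := integral_gt0 P mG Gp.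
(* If one integral is infinite, so is the product, because the other one is positive. *)
case EG : (\int[P]_x G x)%E => [b||//]; last first.
  by move=> _ a0; rewrite gt0_muley ?leey.
case EF : (\int[P]_x F x)%E => [a||//]; last first.
  by move=> b0 _; rewrite gt0_mulye ?leey.
rewrite !lte_fin -EFinM lee_fin => b0 a0.
set C := Num.sqrt (k * expR (- I) / (a * b)).
have C0 : 0 <= C by exact: sqrtr_ge0.
have I0 : 0 <= I.
  by rewrite -lee_fin -intw integral_ge0// => x _; rewrite lee_fin.
have key x : ((C * (2 + I))%:E <=
    a^-1%:E * F x + b^-1%:E * G x + C%:E * (w x)%:E)%E.
  have := F0 x; have := G0 x; have := kFG x.
  case: (F x) => [f||//]; case: (G x) => [g||//].
  - rewrite -!EFinM -!EFinD !lee_fin => kfg g0 f0.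
    by rewrite ![_^-1 * _]mulrC; exact: tangent_amgm.
  - by move=> _ _ _; rewrite gt0_muley ?lte_fin ?invr_gt0// addey//= ?addye ?leey//.
  - by move=> _ _ _; rewrite gt0_muley ?lte_fin ?invr_gt0// addye//= ?addye ?leey//.
  - by move=> _ _ _; rewrite !gt0_muley ?lte_fin ?invr_gt0// addye//= ?addye ?leey//.
have mcF (c : R) H : measurable_fun [set: T] H ->
    measurable_fun [set: T] (fun x : T => c%:E * H x)%E.
  by move=> mH; exact: emeasurable_funM.
have mwE : measurable_fun [set: T] (fun x => (w x)%:E) by exact/measurable_EFinP.
have : (\int[P]_x (C * (2 + I))%:E <=
    \int[P]_x (a^-1%:E * F x + b^-1%:E * G x + C%:E * (w x)%:E))%E.
  apply: ge0_le_integral => //.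
  - by move=> x _; rewrite lee_fin mulr_ge0// addr_ge0.
  - by apply: emeasurable_funD; [apply: emeasurable_funD|]; exact: mcF.
have ai : (0 <= a^-1%:E)%E by rewrite lee_fin invr_ge0 ltW.
have bi : (0 <= b^-1%:E)%E by rewrite lee_fin invr_ge0 ltW.
have CE0 : (0 <= C%:E)%E by rewrite lee_fin.
rewrite integral_cst//.
rewrite [X in (_ * X)%E]probability_setT mule1.
rewrite ge0_integralD//; last 4 first.
- by move=> x _; rewrite adde_ge0// mule_ge0.
- by apply: emeasurable_funD; exact: mcF.
- by move=> x _; rewrite mule_ge0// lee_fin.
- exact: mcF.
rewrite ge0_integralD//; last 4 first.
- by move=> x _; rewrite mule_ge0.
- exact: mcF.
- by move=> x _; rewrite mule_ge0.
- exact: mcF.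
rewrite !ge0_integralZl//; last by move=> x _; rewrite lee_fin.
rewrite EF EG intw -!EFinM -!EFinD lee_fin !mulVf ?gt_eqF// => le2.
have C1 : C <= 1 by lra.
have : C ^+ 2 <= 1 by rewrite expr_le1.
have ab0 : 0 < a * b by exact: mulr_gt0.
have kI0 : 0 <= k * expR (- I) by rewrite mulr_ge0 ?expR_ge0// ltW.
rewrite sqr_sqrtr; last exact: divr_ge0 kI0 (ltW ab0).
by rewrite ler_pdivrMr// mul1r.
Qed.

End overlap_core.

(* The best constant [r] is the square of the Hellinger affinity of [P] and
   [Q]; stating it by duality avoids densities altogether. *)
Definition overlap (R : realType) d (T : measurableType d)
    (P Q : probability T R) (r : R) : Prop :=
  forall (F G : T -> \bar R) (k : R),
    measurable_fun [set: T] F -> measurable_fun [set: T] G ->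
    (forall x, (0 <= F x)%E) -> (forall x, (0 <= G x)%E) -> 0 < k ->
    (forall x, (k%:E <= F x * G x)%E) ->
    ((k * r)%:E <= \int[P]_x F x * \int[Q]_x G x)%E.

(** * Multiplicativity of the overlap over product measures *)

Section overlap_product.
Context (R : realType).

(** By Tonelli, the inner integrals of [F] and [G] over the second factor are test functions for the
    first, with [k * r2] in place of [k]; positivity of [r2] keeps this constant positive. *)
Lemma overlap_prod d1 d2 (T1 : measurableType d1) (T2 : measurableType d2)
    (P1 Q1 : probability T1 R) (P2 Q2 : probability T2 R) (r1 r2 : R) :
  0 < r2 -> overlap P1 Q1 r1 -> overlap P2 Q2 r2 ->
  overlap (P1 \x P2)%E (Q1 \x Q2)%E (r1 * r2).
Proof.
move=> r20 o1 o2 F G k mF mG F0 G0 k0 kFG.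
rewrite !fubini_tonelli1// [r1 * _]mulrC mulrA.
apply: o1.
- exact: measurable_fun_fubini_tonelli_F.
- exact: measurable_fun_fubini_tonelli_F.
- by move=> x; exact: integral_ge0.
- by move=> x; exact: integral_ge0.
- exact: mulr_gt0.
- move=> x; apply: o2 => //.
  + exact: measurableT_comp mF (pair1_measurable x).
  + exact: measurableT_comp mG (pair1_measurable x).
Qed.

Lemma overlap_power d (T : measurableType d) (P Q : probability T R) (r : R) n :
  0 < r -> overlap P Q r -> overlap (power_prob P n) (power_prob Q n) (r ^+ n).
Proof.
move=> r0 o; elim: n => [|n IHn] F G k mF mG F0 G0 k0 kFG.
  (* The empty powers are the same Dirac mass, so the pointwise bound at its atom suffices. *)
  rewrite expr0 mulr1 /= !integral_dirac//.
  by rewrite !diracE !mem_set// !mul1e.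
rewrite exprS /= !ge0_integral_distribution//.
apply: (overlap_prod _ o IHn) => //.
- exact: exprn_gt0.
- exact: measurableT_comp mF (@measurable_cons_pair _ _ n).
- exact: measurableT_comp mG (@measurable_cons_pair _ _ n).
- by move=> x; exact: F0.
- by move=> x; exact: G0.
- by move=> x; exact: kFG.
Qed.

End overlap_product.

(** * Gaussian shifts, their overlap, and second moments *)

Section gaussian.
Context (R : realType).
Implicit Types (f : R -> \bar R) (h s m : R).

Lemma lebesgue_measure_shift h (A : set R) : measurable A ->
  pushforward lebesgue_measure (+%R h : _ -> measurableTypeR R) A =
  lebesgue_measure A.
Proof.
move=> mA; apply: esym; apply: lebesgue_measure_unique => //=.
  exact: measurable_funD.
move=> _ _ [[a b]] _ <-.
rewrite /pushforward /=.
rewrite (_ : _ @^-1` _ = `]a - h, b - h]%classic); last first.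
  by apply/seteqP; split => x /=; rewrite !in_itv/= => /andP[? ?];
    apply/andP; split; lra.
rewrite !lebesgue_measure_itv/= !lte_fin ltrD2r; case: ifPn => // _.
by rewrite -!EFinB opprB addrA subrK.
Qed.

Lemma ge0_integral_shift h f :
  measurable_fun [set: R] f -> (forall x, (0 <= f x)%E) ->
  (\int[lebesgue_measure]_x f (h + x)%R = \int[lebesgue_measure]_x f x)%E.
Proof.
move=> mf f0.
have mh : measurable_fun [set: R] (+%R h : _ -> measurableTypeR R).
  exact: measurable_funD.
transitivity (\int[pushforward lebesgue_measure (+%R h : _ -> measurableTypeR R)]_x f x)%E.
  by rewrite ge0_integral_pushforward.
by apply: eq_measure_integral => A mA _; exact: lebesgue_measure_shift.
Qed.

Lemma ge0_integral_opp f :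
  measurable_fun [set: R] f -> (forall x, (0 <= f x)%E) ->
  (\int[lebesgue_measure]_x f (- x)%R = \int[lebesgue_measure]_x f x)%E.
Proof.
move=> mf f0.
transitivity (\int[pushforward lebesgue_measure (-%R : _ -> measurableTypeR R)]_x f x)%E.
  by rewrite ge0_integral_pushforward.
by apply: eq_measure_integral => A mA _; exact: lebesgue_measureN.
Qed.

(** The Radon-Nikodym derivative of [normal_prob] agrees almost everywhere with [normal_pdf], since
    both have the same integral over every measurable set. *)
Lemma ge0_integral_normal_prob m s f :
  measurable_fun [set: R] f -> (forall x, (0 <= f x)%E) ->
  (\int[normal_prob m s]_x f x =
   \int[lebesgue_measure]_x (f x * (normal_pdf m s x)%:E))%E.
Proof.
move=> mf f0.
have dom := normal_prob_dominates m s.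
have int_rn := Radon_Nikodym_SigmaFinite.f_integrable dom.
rewrite -(Radon_Nikodym_SigmaFinite.change_of_variables dom)//.
have mpdf : measurable_fun [set: R] (fun x => (normal_pdf m s x)%:E).
  by apply/measurable_EFinP; exact: measurable_normal_pdf.
apply: ae_eq_integral => //.
- by apply: emeasurable_funM => //; exact: measurable_int int_rn.
- exact: emeasurable_funM.
- apply: ae_eqe_mul2l; apply: integral_ae_eq => // A _ mA.
  by rewrite -Radon_Nikodym_SigmaFinite.f_integral.
Qed.

Lemma normal_pdf_shift s h x : s != 0 ->
  normal_pdf 0 s (x - h) =
  normal_pdf 0 s x * expR ((h * x - h ^+ 2 / 2) / s ^+ 2).
Proof.
move=> s0; rewrite normal_pdfE// /normal_fun -mulrA -expRD.
by congr (_ * expR _); field.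
Qed.

Lemma measurable_normal_tilt s h : measurable_fun [set: R]
  (fun x => (expR ((h * x - h ^+ 2 / 2) / s ^+ 2))%:E).
Proof.
apply/measurable_EFinP; apply: (measurableT_comp (f := @expR R)) => //.
apply: measurable_funM => //; apply: measurable_funB => //.
Qed.

(** The Cameron-Martin formula in dimension one: a translation of the centered gaussian is an
    exponential tilt of it. *)
Lemma ge0_integral_normal_shift s h f : s != 0 ->
  measurable_fun [set: R] f -> (forall x, (0 <= f x)%E) ->
  (\int[normal_prob 0 s]_x f (h + x)%R =
   \int[normal_prob 0 s]_x (f x * (expR ((h * x - h ^+ 2 / 2) / s ^+ 2))%:E))%E.
Proof.
move=> s0 mf f0.
have me := measurable_normal_tilt s h.
have mpdf : measurable_fun [set: R] (fun x => (normal_pdf 0 s x)%:E).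
  by apply/measurable_EFinP; exact: measurable_normal_pdf.
rewrite ge0_integral_normal_prob//; last first.
  by apply: measurableT_comp => //; exact: measurable_funD.
rewrite ge0_integral_normal_prob//; last 2 first.
- exact: emeasurable_funM.
- by move=> x; rewrite mule_ge0// lee_fin expR_ge0.
pose g x := (f x * (normal_pdf 0 s (x - h))%:E)%E.
transitivity (\int[lebesgue_measure]_x g (h + x)%R)%E.
  by apply: eq_integral => x _; rewrite /g addrAC subrr add0r.
rewrite ge0_integral_shift//; last 2 first.
- apply: emeasurable_funM => //; apply: (measurableT_comp mpdf).
  exact: measurable_funB.
- by move=> x; rewrite mule_ge0// lee_fin normal_pdf_ge0.
apply: eq_integral => x _; rewrite /g normal_pdf_shift// mulrC EFinM muleA.
by [].
Qed.

Lemma ge0_integral_normal_opp s f : s != 0 ->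
  measurable_fun [set: R] f -> (forall x, (0 <= f x)%E) ->
  (\int[normal_prob 0 s]_x f (- x)%R = \int[normal_prob 0 s]_x f x)%E.
Proof.
move=> s0 mf f0.
have mpdf : measurable_fun [set: R] (fun x => (normal_pdf 0 s x)%:E).
  by apply/measurable_EFinP; exact: measurable_normal_pdf.
rewrite !ge0_integral_normal_prob//; last exact: measurableT_comp.
rewrite -[RHS]ge0_integral_opp//; last 2 first.
- exact: emeasurable_funM.
- by move=> x; rewrite mule_ge0// lee_fin normal_pdf_ge0.
apply: eq_integral => x _; rewrite normal_pdfE// /normal_fun.
by rewrite !subr0 sqrrN.
Qed.

(** Seen from the midpoint [m], the two laws are tilts of one gaussian by [h] and [- h]. The product
    of the tilts is the constant [expR (- (h ^+ 2 / s ^+ 2))], so [overlap_core] applies with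
    constant [w]. *)
Lemma overlap_normal_shift s u v (F G : R -> \bar R) (k : R) : s != 0 ->
  measurable_fun [set: R] F -> measurable_fun [set: R] G ->
  (forall x, (0 <= F x)%E) -> (forall x, (0 <= G x)%E) -> 0 < k ->
  (forall x, (k%:E <= F x * G x)%E) ->
  ((k * expR (- ((u - v) ^+ 2 / (4 * s ^+ 2))))%:E <=
   \int[normal_prob 0 s]_x F (u + x)%R * \int[normal_prob 0 s]_x G (v + x)%R)%E.
Proof.
move=> s0 mF mG F0 G0 k0 kFG.
set m := (u + v) / 2; set h := (u - v) / 2.
have -> : (\int[normal_prob 0 s]_x F (u + x)%R =
    \int[normal_prob 0 s]_x (F (m + x)%R * (expR ((h * x - h ^+ 2 / 2) / s ^+ 2))%:E))%E.
  rewrite -(@ge0_integral_normal_shift _ _ (fun x => F (m + x)))//.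
  - by apply: eq_integral => x _; congr F; rewrite /m /h; lra.
  - by apply: measurableT_comp => //; exact: measurable_funD.
have -> : (\int[normal_prob 0 s]_x G (v + x)%R =
    \int[normal_prob 0 s]_x (G (m + x)%R * (expR ((- h * x - (- h) ^+ 2 / 2) / s ^+ 2))%:E))%E.
  rewrite -(@ge0_integral_normal_shift _ _ (fun x => G (m + x)))//.
  - by apply: eq_integral => x _; congr G; rewrite /m /h; lra.
  - by apply: measurableT_comp => //; exact: measurable_funD.
have me := measurable_normal_tilt s.
have mm : measurable_fun [set: R] (fun x : R => m + x) by exact: measurable_funD.
apply: (@overlap_core _ _ _ _ (cst ((u - v) ^+ 2 / (4 * s ^+ 2)))) => //.
- by move=> x; apply: divr_ge0; rewrite ?sqr_ge0// mulr_ge0// sqr_ge0.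
- by rewrite /= integral_cst// [X in (_ * X)%E]probability_setT mule1.
- exact: emeasurable_funM (measurableT_comp mF mm) (me h).
- exact: emeasurable_funM (measurableT_comp mG mm) (me (- h)).
- by move=> x; rewrite mule_ge0// lee_fin expR_ge0.
- by move=> x; rewrite mule_ge0// lee_fin expR_ge0.
- move=> x; rewrite muleACA -EFinM -expRD EFinM /=.
  rewrite (_ : (h * x - _) / _ + _ = - ((u - v) ^+ 2 / (4 * s ^+ 2))).
    by apply: lee_wpmul2r => //; rewrite lee_fin expR_ge0.
  by rewrite /h; field.
Qed.

Lemma integral_normal_tilt s h : s != 0 ->
  (\int[normal_prob 0 s]_x (expR ((h * x - h ^+ 2 / 2) / s ^+ 2))%:E = 1)%E.
Proof.
move=> s0; have := @ge0_integral_normal_shift s h (cst 1%E) s0.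
move=> /(_ (measurable_cst _) (fun=> lee01)).
rewrite /= integral_cst// [X in (_ * X)%E]probability_setT mule1 => ->.
by apply: eq_integral => x _; rewrite mul1e.
Qed.

Lemma sqr_le_expR (x : R) : x ^+ 2 <= 2 * (expR x + expR (- x)).
Proof.
wlog x0 : x / 0 <= x.
  move=> H; have [|x0] := leP 0 x; first exact: H.
  by have := H (- x); rewrite sqrrN opprK addrC; apply; lra.
have := @expR_ge1Dxn R x 1 x0; have := expR_ge0 (- x).
by rewrite (_ : 2`!%:R = 2 :> R)//; lra.
Qed.

(** Only finiteness matters, since [V] cancels when risks are compared. *)
Lemma normal_second_moment s : s != 0 ->
  exists V : R, (\int[normal_prob 0 s]_x (x ^+ 2)%:E = V%:E)%E.
Proof.
move=> s0; have s20 : s ^+ 2 != 0 by rewrite expf_neq0.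
pose tilt h x := (expR ((h * x - h ^+ 2 / 2) / s ^+ 2))%:E.
(* The tilts at [h = s ^+ 2] and [h = - s ^+ 2] are [expR (x - s ^+ 2 / 2)] and
   [expR (- x - s ^+ 2 / 2)]; [C] turns their sum into the bound of [sqr_le_expR]. *)
pose C := 2 * expR (s ^+ 2 / 2).
have C0 : 0 <= C by rewrite mulr_ge0// expR_ge0.
have t0 h x : (0 <= tilt h x)%E by rewrite lee_fin expR_ge0.
have mt h : measurable_fun [set: R] (tilt h) by exact: measurable_normal_tilt.
have int_le : (\int[normal_prob 0 s]_x (x ^+ 2)%:E <= C%:E * (1 + 1))%E.
  rewrite -{1}(integral_normal_tilt (s ^+ 2) s0)
    -(integral_normal_tilt (- s ^+ 2) s0).
  rewrite -ge0_integralD//; try (by move=> x _; exact: t0); try exact: mt.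
  rewrite -ge0_integralZl//.
  - apply: ge0_le_integral => //.
    + by move=> x _; rewrite lee_fin sqr_ge0.
    + by apply/measurable_EFinP; exact: measurable_funX.
    + by apply: emeasurable_funM => //; apply: emeasurable_funD; exact: mt.
    + move=> x _; rewrite -EFinD -EFinM lee_fin /C -mulrA mulrDr -!expRD.
      rewrite (_ : _ + _ / _ = x); last by field.
      rewrite (_ : _ + (- _ * _ - _) / _ = - x); last by field.
      exact: sqr_le_expR.
  - by apply: emeasurable_funD; exact: mt.
  - by move=> x _; rewrite adde_ge0// t0.
exists (fine (\int[normal_prob 0 s]_x (x ^+ 2)%:E)%E); rewrite fineK// ge0_fin_numE.
  by apply: le_lt_trans int_le _; rewrite -EFinD -EFinM ltry.
by apply: integral_ge0 => x _; rewrite lee_fin sqr_ge0.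
Qed.

Lemma normal_bias_variance s (a V : R) : s != 0 ->
  (\int[normal_prob 0 s]_x (x ^+ 2)%:E = V%:E)%E ->
  (\int[normal_prob 0 s]_x ((a - x) ^+ 2)%:E = (a ^+ 2 + V)%:E)%E.
Proof.
move=> s0 EV.
have mB (b : R) : measurable_fun [set: R] (fun x => ((a + b * x) ^+ 2)%:E).
  apply/measurable_EFinP; apply: measurable_funX.
  exact: measurable_funD.
have mS : measurable_fun [set: R] (fun x : R => (x ^+ 2)%:E).
  by apply/measurable_EFinP; exact: measurable_funX.
have ge0 (b x : R) : (0 <= ((a + b * x) ^+ 2)%:E)%E by rewrite lee_fin sqr_ge0.
(* Reflection symmetry stands in for the vanishing of the mean. *)
have symm : (\int[normal_prob 0 s]_x ((a + 1 * x) ^+ 2)%:E =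
             \int[normal_prob 0 s]_x ((a + -1 * x) ^+ 2)%:E)%E.
  rewrite -(@ge0_integral_normal_opp s (fun x => ((a + 1 * x) ^+ 2)%:E))//.
  by apply: eq_integral => x _; rewrite mul1r mulN1r.
transitivity (\int[normal_prob 0 s]_x ((a + -1 * x) ^+ 2)%:E)%E.
  by apply: eq_integral => x _; rewrite mulN1r.
(* The cross terms cancel in the sum, and by symmetry each integral is half of it. *)
have : (\int[normal_prob 0 s]_x ((a + 1 * x) ^+ 2)%:E +
        \int[normal_prob 0 s]_x ((a + -1 * x) ^+ 2)%:E = (2 * (a ^+ 2 + V))%:E)%E.
  rewrite -ge0_integralD//; try exact: mB.
  transitivity (\int[normal_prob 0 s]_x ((2 * a ^+ 2)%:E + 2%:E * (x ^+ 2)%:E))%E.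
    by apply: eq_integral => x _; rewrite -EFinD -EFinM -EFinD; congr EFin; ring.
  rewrite ge0_integralD//.
  - rewrite integral_cst// [X in (_ * X)%E]probability_setT mule1 ge0_integralZl//.
    + by rewrite EV -EFinM -EFinD mulrDr.
    + by move=> x _; rewrite lee_fin sqr_ge0.
  - by move=> x _; rewrite lee_fin mulr_ge0// sqr_ge0.
  - by move=> x _; rewrite -EFinM lee_fin mulr_ge0// sqr_ge0.
  - exact: emeasurable_funM.
rewrite symm; case: (\int[_]_x _)%E => [r| |]//.
by rewrite -EFinD => -[] rE; congr EFin; lra.
Qed.

End gaussian.

(** * From overlap to a lower bound on testing errors *)

Section testing.
Context (R : realType) d (T : measurableType d).

Lemma integral_two_valued (P : probability T R) (A : set T) (a b : R) :
  measurable A -> 0 <= a -> 0 <= b ->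
  (\int[P]_x (a * \1_A x + b * \1_(~` A) x)%:E =
   a%:E * P A + b%:E * P (~` A))%E.
Proof.
move=> mA a0 b0; have mAC := measurableC mA.
under eq_integral do rewrite EFinD !EFinM.
have mi (c : R) (C : set T) : measurable C ->
    measurable_fun [set: T] (fun x => c%:E * (\1_C x)%:E)%E.
  by move=> mC; apply/measurable_EFinP; exact: measurable_funM.
rewrite ge0_integralD//; try exact: mi; try by move=> x _; rewrite mule_ge0.
by rewrite !ge0_integralZl// ?integral_indic ?setIT//; exact/measurable_EFinP.
Qed.

(* The test functions [1] on [A] and [K], resp. [1/K], off [A], with
   [K = (1 - delta) / delta], are optimal for errors equal to [delta]. *)
Lemma overlap_testing (P Q : probability T R) (r delta : R) (A B : set T) :
  overlap P Q r -> measurable A -> measurable B -> A `&` B = set0 ->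
  0 < delta -> delta <= 1 / 2 ->
  ((1 - delta)%:E <= P A)%E -> ((1 - delta)%:E <= Q B)%E ->
  r <= 4 * (delta * (1 - delta)).
Proof.
move=> o mA mB AB0 d0 d12 PA QB.
pose K := (1 - delta) / delta.
have K0 : 0 < K by rewrite divr_gt0//; lra.
have K1 : 1 <= K by rewrite ler_pdivlMr//; lra.
have Ki0 : 0 < K^-1 by rewrite invr_gt0.
have KKi : K * K^-1 = 1 by rewrite divff// gt_eqF.
have mAC := measurableC mA.
have [p pE] : exists p, P A = p%:E.
  by exists (fine (P A)); rewrite fineK// fin_num_measure.
have [q qE] : exists q, Q A = q%:E.
  by exists (fine (Q A)); rewrite fineK// fin_num_measure.
have [q' q'E] : exists q', Q B = q'%:E.
  by exists (fine (Q B)); rewrite fineK// fin_num_measure.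
have := PA; have := QB; rewrite pE q'E !lee_fin => q'd pd.
have p1 : p <= 1 by rewrite -lee_fin -pE probability_le1.
have q0 : 0 <= q by rewrite -lee_fin -qE.
(* Disjointness puts [A] inside the complement of [B]. *)
have qd : q <= delta.
  have : (Q A <= Q (~` B))%E.
    apply: le_measure; rewrite ?inE//; first exact: measurableC.
    by move=> x Ax Bx; have : (A `&` B) x by []; rewrite AB0.
  by rewrite probability_setC// qE q'E -EFinB lee_fin; lra.
have mtv (a b : R) : measurable_fun [set: T]
    (fun x => (a * \1_A x + b * \1_(~` A) x)%:E).
  by apply/measurable_EFinP; apply: measurable_funD; exact: measurable_funM.
have := o (fun x => (1 * \1_A x + K * \1_(~` A) x)%:E)
  (fun x => (1 * \1_A x + K^-1 * \1_(~` A) x)%:E) 1 (mtv _ _) (mtv _ _).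
have K0' := ltW K0; have Ki0' := ltW Ki0.
rewrite !integral_two_valued// !probability_setC// pE qE !mul1e.
rewrite -!EFinB -!EFinM lee_fin mul1r => H.
apply: le_trans (H _ _ _ _) _ => //.
- by move=> x; rewrite lee_fin addr_ge0// mulr_ge0// ltW.
- by move=> x; rewrite lee_fin addr_ge0// mulr_ge0// ltW.
- move=> x; rewrite -EFinM lee_fin !indicE in_setC.
  by case: (x \in A) => /=; rewrite !(mulr1, mulr0, mul1r, addr0, add0r) ?KKi.
have Kd : K * delta = 1 - delta by rewrite divfK// gt_eqF.
have Kid : K^-1 * (1 - delta) = delta by rewrite -Kd mulKf// gt_eqF.
have Ki1 : K^-1 <= 1 by rewrite invf_le1.
(* As [K >= 1], the first factor decreases in [p >= 1 - delta] and the second increases in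
   [q <= delta]; the extreme values give [2 * (1 - delta)] and [2 * delta]. *)
rewrite (_ : 4 * _ = (2 * (1 - delta)) * (2 * delta)); last by ring.
apply: ler_pM.
- by apply: addr_ge0; [lra|apply: mulr_ge0 => //; lra].
- by apply: addr_ge0; [lra|apply: mulr_ge0 => //; lra].
- nra.
- nra.
Qed.

End testing.

(** * The regression model with independent gaussian noise *)

Section noise_model.
Context (R : realType) d (Omega : measurableType d) (mu : probability Omega R).
Context d' (T : measurableType d') (P : probability T R).
Variables (X : {RV P >-> Omega}) (W : {RV P >-> R}) (sigma : R).
Hypothesis X_law : forall A, measurable A -> distribution P X A = mu A.
Hypothesis sigma0 : sigma != 0.
Hypothesis W_law :
  forall B, measurable B -> distribution P W B = normal_prob 0 sigma B.
Hypothesis XW_indep : independent_rv X W.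

(* [normal_prob] and [distribution P W] live on copies of [R] with different
   measure displays; the pushforward by the identity goes from one to the
   other. *)
Lemma ge0_integral_noise (f : R -> \bar R) :
  measurable_fun [set: R] f -> (forall w, (0 <= f w)%E) ->
  (\int[distribution P W]_w f w = \int[normal_prob 0 sigma]_w f w)%E.
Proof.
move=> mf f0.
have mid : measurable_fun [set: measurableTypeR R] (id : measurableTypeR R -> R).
  exact: measurable_id.
transitivity (\int[pushforward (normal_prob 0 sigma) (id : measurableTypeR R -> R)]_w f w)%E.
  by apply: eq_measure_integral => A mA _; exact: W_law.
by rewrite ge0_integral_pushforward.
Qed.

(** Independence fixes the joint law on rectangles, hence identifies it with the product measure;
    Tonelli does the rest. *)
Lemma ge0_integral_noise_model (f : Omega * R -> \bar R) :
  measurable_fun [set: Omega * R] f -> (forall z, (0 <= f z)%E) ->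
  (\int[P]_t f (X t, W t) = \int[mu]_x \int[distribution P W]_w f (x, w))%E.
Proof.
move=> mf f0.
transitivity (\int[distribution P (rv_pair X W)]_z f z)%E.
  by rewrite ge0_integral_distribution.
rewrite -[RHS]/(\int[mu]_x fubini_F (distribution P W) f x)%E.
rewrite -fubini_tonelli1//; apply: eq_measure_integral => A mA _.
apply/esym; apply: product_measure_unique => // B C mB mC.
transitivity (distribution P X B * distribution P W C)%E; first exact: XW_indep.
by congr (_ * _)%E; exact: X_law.
Qed.

(** Given [X = x], the targets are gaussians centered at [u x] and [v x]. [overlap_normal_shift]
    bounds the product of the inner integrals from below, and [overlap_core] averages the exponent
    over [mu]. *)
Lemma overlap_targets (u v : Omega -> R) (Yu Yv : {RV P >-> R}) (D : R) :
  measurable_fun [set: Omega] u -> measurable_fun [set: Omega] v ->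
  (forall t, Yu t = u (X t) + W t) -> (forall t, Yv t = v (X t) + W t) ->
  (\int[mu]_x ((u x - v x) ^+ 2)%:E = D%:E)%E ->
  overlap (distribution P (rv_pair X Yu)) (distribution P (rv_pair X Yv))
    (expR (- (D / (4 * sigma ^+ 2)))).
Proof.
move=> mu_ mv YuE YvE DE F G k mF mG F0 G0 k0 kFG.
have mshift (h : Omega -> R) : measurable_fun [set: Omega] h ->
    measurable_fun [set: Omega * R] (fun z => (z.1, h z.1 + z.2)).
  move=> mh; apply: measurable_fun_pair => //; apply: measurable_funD => //.
  exact: measurableT_comp mh measurable_fst.
have lawE (h : Omega -> R) (Y : {RV P >-> R}) (H : Omega * R -> \bar R) :
    measurable_fun [set: Omega] h -> (forall t, Y t = h (X t) + W t) ->
    measurable_fun [set: Omega * R] H -> (forall z, (0 <= H z)%E) ->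
    (\int[distribution P (rv_pair X Y)]_z H z =
     \int[mu]_x \int[distribution P W]_w H (x, (h x + w)%R))%E.
  move=> mh YE mH H0; rewrite ge0_integral_distribution//.
  rewrite -(@ge0_integral_noise_model (fun z => H (z.1, h z.1 + z.2)))//.
    by apply: eq_integral => t _; rewrite /= /rv_pair YE.
  exact: measurableT_comp mH (mshift _ mh).
rewrite (lawE u)// (lawE v)//.
have s20 : 0 < 4 * sigma ^+ 2 by rewrite mulr_gt0// exprn_even_gt0.
have mint (h : Omega -> R) (H : Omega * R -> \bar R) :
    measurable_fun [set: Omega] h ->
    measurable_fun [set: Omega * R] H -> (forall z, (0 <= H z)%E) ->
    measurable_fun [set: Omega]
      (fun x => \int[distribution P W]_w H (x, (h x + w)%R))%E.
  move=> mh mH H0.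
  apply: (@measurable_fun_fubini_tonelli_F _ _ _ _ _ _
    (fun z => H (z.1, h z.1 + z.2))) => //.
  exact: measurableT_comp mH (mshift _ mh).
have msq : measurable_fun [set: Omega] (fun x => (u x - v x) ^+ 2).
  by apply: measurable_funX; exact: measurable_funB.
apply: (@overlap_core _ _ _ _ (fun x => (u x - v x) ^+ 2 / (4 * sigma ^+ 2))) => //.
- exact: measurable_funM.
- by move=> x; rewrite divr_ge0 ?sqr_ge0// ltW.
- under eq_integral do rewrite EFinM.
  rewrite ge0_integralZr//.
  + by rewrite DE.
  + exact/measurable_EFinP.
  + by move=> x _; rewrite lee_fin sqr_ge0.
  + by rewrite lee_fin invr_ge0 ltW.
- exact: mint.
- exact: mint.
- by move=> x; apply: integral_ge0.
- by move=> x; apply: integral_ge0.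
- move=> x.
  have mF' : measurable_fun [set: R] (fun y => F (x, y)).
    exact: measurableT_comp mF (pair1_measurable x).
  have mG' : measurable_fun [set: R] (fun y => G (x, y)).
    exact: measurableT_comp mG (pair1_measurable x).
  have ms (c : R) : measurable_fun [set: R] (fun w => c + w).
    exact: measurable_funD.
  rewrite !ge0_integral_noise//.
  + apply: (@overlap_normal_shift _ _ _ _ (fun y => F (x, y))
      (fun y => G (x, y))) => //.
  + exact: measurableT_comp mG' (ms _).
  + exact: measurableT_comp mF' (ms _).
Qed.

(** The noise is centered and independent of [X], so the cross term vanishes. Thus excess risk is
    squared distance to [u]. *)
Lemma risk_target (h u : Omega -> R) (Y : {RV P >-> R}) (V : R) :
  measurable_fun [set: Omega] h -> measurable_fun [set: Omega] u ->
  (forall t, Y t = u (X t) + W t) ->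
  (\int[normal_prob 0 sigma]_w (w ^+ 2)%:E = V%:E)%E ->
  risk X Y h = (\int[mu]_x ((h x - u x) ^+ 2)%:E + V%:E)%E.
Proof.
move=> mh mu_ YE VE; rewrite /risk unlock.
pose f (z : Omega * R) := ((h z.1 - u z.1 - z.2) ^+ 2)%:E.
transitivity (\int[P]_t f (X t, W t))%E.
  by apply: eq_integral => t _; rewrite /f /= YE opprD addrA.
rewrite ge0_integral_noise_model; first last.
- by move=> z; rewrite lee_fin sqr_ge0.
- apply/measurable_EFinP; apply: measurable_funX; apply: measurable_funB => //.
  by apply: measurable_funB; apply: measurableT_comp.
have V0 : (0 <= V%:E)%E.
  by rewrite -VE integral_ge0// => x _; rewrite lee_fin sqr_ge0.
under eq_integral => x _.
  rewrite ge0_integral_noise; first last.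
  - by move=> w; rewrite lee_fin sqr_ge0.
  - apply/measurable_EFinP; apply: measurable_funX => /=.
    exact: measurable_funB.
  rewrite /f /= (normal_bias_variance (h x - u x) sigma0 VE) EFinD; over.
rewrite ge0_integralD//.
- by rewrite integral_cst// [X in (_ * X)%E]probability_setT mule1.
- by move=> x _; rewrite lee_fin sqr_ge0.
- by apply/measurable_EFinP; apply: measurable_funX; exact: measurable_funB.
Qed.

End noise_model.

(** * Choice of two functions at a prescribed distance in [F] *)

Section separated_pair.
Context (R : realType) d (Omega : measurableType d) (mu : probability Omega R).
Implicit Types f h u v : Omega -> R.

Lemma Lfun_measurable p f : f \in Lfun mu p -> measurable_fun [set: Omega] f.
Proof. by move=> /sub_Lfun_mfun; rewrite inE. Qed.

Lemma Lfun2_sqr_dist f h : f \in Lfun mu 2%:E -> h \in Lfun mu 2%:E ->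
  exists D : R, (\int[mu]_x ((f x - h x) ^+ 2)%:E = D%:E)%E.
Proof.
move=> Lf Lh.
have L2 : (1 <= 2%:E :> \bar R)%E by rewrite lee_fin; lra.
have Lfh : f \- h \in Lfun mu 2%:E.
  by rewrite rpredB.
have /integrable_fin_num := Lfun2_integrable_sqr Lfh.
move=> /(_ measurableT) fin.
by exists (fine (\int[mu]_x ((f x - h x) ^+ 2)%:E)%E); rewrite fineK.
Qed.

Lemma Lnorm2_sqr f :
  (('N[mu]_2[EFin \o f]) ^+ 2 = \int[mu]_x ((f x) ^+ 2)%:E)%E.
Proof.
have N0 : (0 <= 'N[mu]_2[EFin \o f])%E by exact: Lnorm_ge0.
have two0 : (1 + 1 != 0 :> R)%R by rewrite gt_eqF//; lra.
rewrite expe2 -{1 2}(poweRe1 N0) -poweRD; last exact: add_neq0_poweRD_def.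
rewrite powR_Lnorm//; apply: eq_integral => x _ /=.
by rewrite powR_mulrn// real_normK// num_real.
Qed.

(** By contraposition: if no pair is that far apart, all distances, hence the diameter, are at most
    [Num.sqrt (4 * eps)]. This also covers an infinite diameter. *)
Lemma L2_diam_gt (F : set (Omega -> R)) (eps : R) : 0 < eps -> F !=set0 ->
  F `<=` [set f : Omega -> R | f \in Lfun mu 2%:E] ->
  (eps%:E < (1 / 4)%:E * L2_diam mu F ^+ 2)%E ->
  exists f h D, [/\ F f, F h,
    (\int[mu]_x ((f x - h x) ^+ 2)%:E = D%:E)%E & 4 * eps < D].
Proof.
move=> e0 [g Fg] FL; apply: contraPP => /forallNP noD.
apply/negP; rewrite -leNgt.
have r0 : 0 <= Num.sqrt (4 * eps) by exact: sqrtr_ge0.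
have rr : Num.sqrt (4 * eps) * Num.sqrt (4 * eps) = 4 * eps.
  by rewrite -expr2 sqr_sqrtr// mulr_ge0// ltW.
have le_r : (L2_diam mu F <= (Num.sqrt (4 * eps))%:E)%E.
  apply: ge_ereal_sup => _ [f Ff [h Fh <-]].
  have [D DE] := Lfun2_sqr_dist (FL _ Ff) (FL _ Fh).
  rewrite leNgt; apply/negP => lt_r; apply: (noD f); exists h, D; split => //.
  rewrite -lte_fin -DE -[X in (_ < X)%E](Lnorm2_sqr (f \- h)).
  rewrite expe2 -rr; move: lt_r; case: ('N[mu]_2[_])%E => [y||]//.
    by rewrite -EFinM !lte_fin => ry; apply: ltr_pM.
  by move=> _; rewrite mulyy ltry.
(* Squaring [le_r] needs a nonnegative left side; the pair of [g] with itself provides it, whereas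
   an empty supremum would be [-oo]. *)
have diam0 : (0 <= L2_diam mu F)%E.
  apply: (@le_trans _ _ 'N[mu]_2[EFin \o (g \- g)%R])%E; first exact: Lnorm_ge0.
  by apply: ereal_sup_ubound; exists g => //; exists g.
have -> : eps%:E = ((1 / 4)%:E * (4 * eps)%:E)%E by rewrite -EFinM; congr EFin; lra.
rewrite expe2.
apply: lee_wpmul2l; first by rewrite lee_fin; lra.
rewrite -rr EFinM.
exact: lee_pmul.
Qed.

(** Contracting [f] and [h] towards the center by the same factor [t] multiplies their squared
    distance by [t ^+ 2]. The strict lower bound separates the balls of squared radius [eps]; the
    upper bound relates [D'] back to [eps]. *)
Lemma star_shaped_pair (F : set (Omega -> R)) (eps D : R) f h : 0 < eps ->
  star_shaped F -> F f -> F h -> measurable_fun [set: Omega] (f \- h) ->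
  (\int[mu]_x ((f x - h x) ^+ 2)%:E = D%:E)%E -> 4 * eps < D ->
  exists u v D', [/\ F u, F v,
    (\int[mu]_x ((u x - v x) ^+ 2)%:E = D'%:E)%E & 4 * eps < D' <= 5 * eps].
Proof.
move=> e0 [f0 Ff0 star] Ff Fh mfh DE epsD.
have D0 : 0 < D by lra.
(* Either [D] is already in range and [t = 1], or [t] is chosen with [t ^+ 2 * D = 5 * eps]. *)
have [t [t01 tD]] : exists t, 0 <= t <= 1 /\ 4 * eps < t ^+ 2 * D <= 5 * eps.
  have [le5|lt5] := leP D (5 * eps).
    by exists 1; rewrite expr1n mul1r ler01 lexx epsD.
  have q0 : 0 <= 5 * eps / D by rewrite divr_ge0// ?ltW// mulr_gt0.
  exists (Num.sqrt (5 * eps / D)); rewrite sqrtr_ge0 sqr_sqrtr//.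
  rewrite divfK ?gt_eqF// lexx andbT; split; last lra.
  by rewrite -[leRHS]sqrtr1 ler_sqrt// ler_pdivrMr//; lra.
exists (fun x => (1 - t) * f0 x + t * f x), (fun x => (1 - t) * f0 x + t * h x).
exists (t ^+ 2 * D); split => //; [exact: star|exact: star|].
rewrite EFinM -DE -ge0_integralZl//.
- by apply: eq_integral => x _; rewrite -EFinM; congr EFin; ring.
- by apply/measurable_EFinP; exact: measurable_funX.
- by move=> x _; rewrite lee_fin sqr_ge0.
- by rewrite lee_fin sqr_ge0.
Qed.

(* [(a - b)^2 <= 2 (c - a)^2 + 2 (c - b)^2], integrated *)
Lemma sqr_dist_le f u v (D e : R) :
  measurable_fun [set: Omega] f -> measurable_fun [set: Omega] u ->
  measurable_fun [set: Omega] v ->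
  (\int[mu]_x ((u x - v x) ^+ 2)%:E = D%:E)%E ->
  (\int[mu]_x ((f x - u x) ^+ 2)%:E <= e%:E)%E ->
  (\int[mu]_x ((f x - v x) ^+ 2)%:E <= e%:E)%E -> D <= 4 * e.
Proof.
move=> mf mu_ mv DE fu fv.
have msq (g : Omega -> R) : measurable_fun [set: Omega] g ->
    measurable_fun [set: Omega] (fun x => ((f x - g x) ^+ 2)%:E).
  move=> mg; apply/measurable_EFinP; apply: measurable_funX.
  exact: measurable_funB.
have sq0 (g : Omega -> R) x : (0 <= ((f x - g x) ^+ 2)%:E)%E.
  by rewrite lee_fin sqr_ge0.
rewrite -lee_fin -DE.
apply: (@le_trans _ _ (2%:E * (\int[mu]_x ((f x - u x) ^+ 2)%:E +
                               \int[mu]_x ((f x - v x) ^+ 2)%:E))%E).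
  rewrite -ge0_integralD//; try exact: msq.
  rewrite -ge0_integralZl//; last 2 first.
  - by apply: emeasurable_funD; exact: msq.
  - by move=> x _; rewrite adde_ge0.
  apply: ge0_le_integral => //.
  - by move=> x _; rewrite lee_fin sqr_ge0.
  - by apply/measurable_EFinP; apply: measurable_funX; exact: measurable_funB.
  - by apply: emeasurable_funM => //; apply: emeasurable_funD; exact: msq.
  - move=> x _; rewrite -EFinD -EFinM lee_fin.
    have := sqr_ge0 (f x - u x + (f x - v x)); nra.
have -> : (4 * e)%:E = (2%:E * (e%:E + e%:E))%E.
  by rewrite -EFinD -EFinM; congr EFin; lra.
by apply: lee_wpmul2l; [rewrite lee_fin|exact: leeD].
Qed.

End separated_pair.

(** * The numerical constant and the conclusion *)

Lemma overlap_exponent_bound (R : realType) (delta eps D s : R) (N : nat) :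
  0 < delta < 1 / 4 -> 0 < s -> (0 < N)%N -> D <= 5 * eps ->
  expR (- (D / (4 * s ^+ 2))) ^+ N <= 4 * (delta * (1 - delta)) ->
  2 / 15 * s ^+ 2 * (ln (1 / delta) / N%:R) <= eps.
Proof.
move=> /andP[d0 d4] s0 N0 D5 H.
have NR : 0 < N%:R :> R by rewrite ltr0n.
have s20 : 0 < s ^+ 2 by rewrite exprn_gt0.
have q0 : 0 <= delta * (1 - delta) by rewrite mulr_ge0//; lra.
(* Since [delta < 1 / 4], [delta * (1 - delta)] is at most [3 / 16]. Pulling one [delta] out of the
   sixth power leaves a factor at most [4096 * (3 / 16) ^+ 5 < 1]. *)
have q6 : (4 * (delta * (1 - delta))) ^+ 6 <= delta.
  have q1 : delta * (1 - delta) <= 3 / 16 by nra.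
  have q5 : (delta * (1 - delta)) ^+ 5 <= (3 / 16) ^+ 5.
    by rewrite ler_pXn2r// nnegrE; lra.
  rewrite (_ : _ ^+ 6 = delta * (4096 * (delta * (1 - delta)) ^+ 5 * (1 - delta)));
    last by ring.
  apply: ler_piMr; first exact: ltW.
  have Q0 : 0 <= (delta * (1 - delta)) ^+ 5 by rewrite exprn_ge0.
  move: ((delta * (1 - delta)) ^+ 5) q5 Q0 => Q Q1 Q0.
  have c1 : 4096 * (3 / 16) ^+ 5 <= 1 :> R by lra.
  have : 4096 * Q * (1 - delta) <= 4096 * Q * 1 by apply: ler_wpM2l; lra.
  lra.
have : (expR (- (D / (4 * s ^+ 2))) ^+ N) ^+ 6 <= delta.
  apply: le_trans q6; rewrite ler_pXn2r// nnegrE ?exprn_ge0 ?expR_ge0//.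
  by rewrite mulr_ge0.
(* Logarithms give [ln (1 / delta) <= 6 * N * q] with [q = D / (4 * s ^+ 2)]. Since [6 * s ^+ 2 * q
   = 3 / 2 * D <= 15 / 2 * eps], the constant is [2 / 15]. *)
rewrite -!expRM_natl -[leRHS]lnK ?posrE// ler_expR.
rewrite div1r lnV ?posrE// => Hl.
set q := D / (4 * s ^+ 2) in Hl.
have DE : D = 4 * (s ^+ 2 * q) by rewrite /q; field; rewrite gt_eqF.
have : - ln delta / N%:R <= 6 * q.
  by rewrite ler_pdivrMr//; lra.
move=> /(ler_wpM2l (ltW s20)); lra.
Qed.

Theorem theoremA (R : realType) :
  exists c : R, 0 < c /\
  forall (d : measure_display) (Omega : measurableType d)
    (mu : probability Omega R) (F : set (Omega -> R))
    (d' : measure_display) (T : measurableType d') (P : probability T R)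
    (X : {RV P >-> Omega}) (W : {RV P >-> R}) (sigma : R)
    (N : nat) (fN : N.-tuple (Omega * R)%type -> Omega -> R) (eps delta : R),
    F `<=` [set f : Omega -> R | f \in Lfun mu 2%:E] ->
    star_shaped F ->
    (forall A, measurable A -> distribution P X A = mu A) ->
    0 < sigma ->
    (forall B, measurable B -> distribution P W B = normal_prob 0 sigma B) ->
    independent_rv X W ->
    (0 < N)%N ->
    (forall s, F (fN s)) ->
    0 < eps ->
    0 < delta < 1 / 4 ->
    performs F X (targets F X W) fN eps delta ->
    (mine (c * sigma ^+ 2 * (ln (1 / delta) / N%:R))%:E
          ((1 / 4)%:E * L2_diam mu F ^+ 2) <= eps%:E)%E.
Proof.
exists (2 / 15); split; first by lra.
move=> d Omega mu F d' T P X W sigma N fN eps delta FL star XL s0 WL indep N0.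
move=> fNF e0 d14 perf.
have sN0 : sigma != 0 by rewrite gt_eqF.
rewrite ge_min orbC; have [//|/= lt_diam] := leP ((1 / 4)%:E * _)%E.
have F0 : F !=set0 by case: star => f0 Ff0 _; exists f0.
have [f [h [D0 [Ff Fh D0E epsD0]]]] := L2_diam_gt e0 F0 FL lt_diam.
have Fm g : F g -> measurable_fun [set: Omega] g.
  by move=> /FL; exact: Lfun_measurable.
have mfh : measurable_fun [set: Omega] (f \- h).
  by apply: measurable_funB; exact: Fm.
have [u [v [D [Fu Fv DE /andP[epsD D5]]]]] :=
  star_shaped_pair e0 star Ff Fh mfh D0E epsD0.
have [V VE] := normal_second_moment sN0.
have target g : F g -> exists Y : {RV P >-> R}, forall t, Y t = g (X t) + W t.
  move=> Fg; have mY : measurable_fun [set: T] (fun t => g (X t) + W t).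
    by apply: measurable_funD => //; exact: measurableT_comp (Fm _ Fg) _.
  by exists (mfun_Sub (mem_set mY)).
have close g (Y : {RV P >-> R}) s : F g -> (forall t, Y t = g (X t) + W t) ->
    (risk X Y (fN s) <= ereal_inf [set risk X Y f | f in F] + eps%:E)%E ->
    (\int[mu]_x ((fN s x - g x) ^+ 2)%:E <= eps%:E)%E.
  (* The function [g] itself has risk [V]; the finite [V] then cancels from both sides of the risk
     bound. *)
  move=> Fg YE; have inf_le : (ereal_inf [set risk X Y f | f in F] <= V%:E)%E.
    apply: ereal_inf_lbound; exists g => //.
    rewrite (risk_target XL sN0 WL indep (Fm _ Fg) (Fm _ Fg) YE VE).
    rewrite integral0_eq ?add0e// => x _.
    by rewrite subrr expr0n.
  rewrite (risk_target XL sN0 WL indep (Fm _ (fNF s)) (Fm _ Fg) YE VE).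
  move=> /le_trans/(_ (leeD inf_le (lexx _))).
  by rewrite [leRHS]addeC leeD2rE.
have [Yu YuE] := target u Fu; have [Yv YvE] := target v Fv.
have [A [mA Asub PA]] := perf Yu (ex_intro2 _ _ u Fu YuE).
have [B [mB Bsub PB]] := perf Yv (ex_intro2 _ _ v Fv YvE).
(* A common sample would put [fN s] within squared distance [eps] of both [u] and [v], forcing
   [D <= 4 * eps]. *)
have AB0 : A `&` B = set0.
  apply/seteqP; split => // s [/Asub /= As /Bsub /= Bs].
  have := sqr_dist_le (Fm _ (fNF s)) (Fm _ Fu) (Fm _ Fv) DE
    (close _ _ _ Fu YuE As) (close _ _ _ Fv YvE Bs).
  lra.
have o := overlap_targets XL sN0 WL indep (Fm _ Fu) (Fm _ Fv) YuE YvE DE.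
have d0 : 0 < delta by lra.
have d12 : delta <= 1 / 2 by lra.
have := overlap_testing (overlap_power (n := N) (expR_gt0 _) o)
  mA mB AB0 d0 d12 PA PB.
by rewrite lee_fin; exact: overlap_exponent_bound.
Qed.
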